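(* Let $\mathbf{x}$ be a Sturmian word. Then the maximum gap between consecutive positions at which cubes end in $\mathbf{x}$ is at most $10$. Moreover, this bound is optimal: there exists a Sturmian word for which the maximum gap between consecutive ending positions of cubes is exactly $10$.
   Context: Words. For a finite word $w = w[0..n-1]$ of length $n\ge 1$, a positive integer $p \le n$ is a period of $w$ if $w[i]=w[i+p]$ for all $i\in\{0,\ldots,n-p-1\}$; the smallest period is denoted $\mathrm{per}(w)$. For a real number $e\ge 1$, $w$ is an $e$-power if $\lceil e\cdot \mathrm{per}(w)\rceil = |w|$, where $|w|$ is the length of $w$. A cube is a $3$-power. A factor of a word is a block of consecutive letters occurring in it. Sturmian words. A Sturmian word is a (right-)infinite word $\mathbf{x}=\mathbf{x}[0]\mathbf{x}[1]\mathbf{x}[2]\cdots$ over $\{0,1\}$ having exactly $n+1$ distinct factors of length $n$ for every $n\ge 0$ (equivalently, an infinite aperiodic binary balanced word). Gaps. A cube ends at position $n$ in $\mathbf{x}$ if there is $m$ with $1\le m\le n$ such that the factor $\mathbf{x}[n-m]\cdots\mathbf{x}[n-1]$ is a cube. Let $p_1<p_2<\cdots$ be the list of all positions at which some cube ends in $\mathbf{x}$. ''The maximum gap is at most $G$'' means that this list is infinite and $p_{i+1}-p_i\le G$ for all $i\ge 1$; the maximum gap is $\max_i (p_{i+1}-p_i)$. *)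

(* Defs.v *)
From mathcomp Require Import all_boot all_order all_algebra.

Set Implicit Arguments.
Unset Strict Implicit.
Unset Printing Implicit Defensive.

Import Order.TTheory GRing.Theory Num.Theory.

(* Finite words over {0,1} are [seq bool] (false = 0, true = 1); infinite words
   are functions [nat -> bool], indexed from 0. *)

Definition is_period (w : seq bool) (p : nat) : bool :=
  [&& 0 < p, p <= size w &
      [forall i : 'I_(size w - p), nth false w i == nth false w (i + p)]].

(* For a nonempty w the default value [size w] of the minimum is itself a
   period, so this is the smallest period; [per [::] = 0] is a junk value. *)
Definition per (w : seq bool) : nat :=
  \big[minn/size w]_(1 <= p < (size w).+1 | is_period w p) p.

(* The exponent is taken in an arbitrary archimedean real field, so that both
   the rationals and any [realType] are covered. *)
Definition is_power (R : archiRealFieldType) (e : R) (w : seq bool) : Prop :=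
  [/\ (1 <= e)%R, w != [::] &
      Num.ceil (e * (per w)%:R)%R = Posz (size w)].

Definition cube (w : seq bool) : Prop := is_power (3%:R : rat)%R w.

(* x[i] ... x[i+n-1] *)
Definition block (x : nat -> bool) (i n : nat) : seq bool :=
  mkseq (fun j => x (i + j)) n.

Definition is_factor (x : nat -> bool) (u : seq bool) : Prop :=
  exists i, u = block x i (size u).

Definition sturmian (x : nat -> bool) : Prop :=
  forall n : nat, exists F : {set n.-tuple bool},
    (forall u : n.-tuple bool, u \in F <-> is_factor x u) /\ #|F| = n.+1.

Definition cube_ends (x : nat -> bool) (n : nat) : Prop :=
  exists m : nat, [/\ 1 <= m, m <= n & cube (block x (n - m) m)].

(* p is the (necessarily infinite) increasing list of all n satisfying P; it is
   indexed from 0, and it is unique when it exists. *)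
Definition increasing_enum (P : nat -> Prop) (p : nat -> nat) : Prop :=
  (forall i, p i < p i.+1) /\ (forall n, P n <-> exists i, p i = n).

Definition max_gap_le (x : nat -> bool) (G : nat) : Prop :=
  exists p : nat -> nat,
    increasing_enum (cube_ends x) p /\ (forall i, p i.+1 - p i <= G).

Definition max_gap_eq (x : nat -> bool) (G : nat) : Prop :=
  exists p : nat -> nat,
    [/\ increasing_enum (cube_ends x) p,
        forall i, p i.+1 - p i <= G &
        exists i, p i.+1 - p i = G].

(* Main.v *)
Require Import Defs.
From mathcomp Require Import all_boot all_order all_algebra.
From mathcomp Require Import zify boolp.

(* A sturmian word is balanced: a minimal unbalanced pair of factors is 0w0, 1w1
   with w a palindrome, so that 0w does not occur in the windows of length
   |w| + 1 starting inside an occurrence of 1w1, and symmetrically for 1w and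
   0w0. By counting, each of these two sets of windows contains the right
   special factor of length |w| + 1, which is 0w or 1w: a contradiction. Balance
   reduces the upper bound to a finite search, because every balanced word of
   length 17 already contains a cube ending at one of its last 10 positions.

   The value 10 is attained by the word of slope sqrt 2 - 1, where cubes end at
   18 and at 28 but nowhere in between. It is balanced and aperiodic, hence has
   exactly one right special factor of each length, hence is sturmian. *)

Set Implicit Arguments.
Unset Strict Implicit.
Unset Printing Implicit Defensive.

(** * Windows and factors of infinite words *)

Lemma size_block x i n : size (block x i n) = n.
Proof. exact: size_mkseq. Qed.

Lemma nth_block x i n k : k < n -> nth false (block x i n) k = x (i + k).
Proof. by move=> ltkn; rewrite nth_mkseq. Qed.

Lemma block_add x i m n :
  block x i (m + n) = block x i m ++ block x (i + m) n.
Proof.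
rewrite /block /mkseq iotaD map_cat add0n -{2}[m]addn0 iotaDl -map_comp.
by congr cat; apply: eq_map => k /=; rewrite addnA.
Qed.

Lemma blockS x i n : block x i n.+1 = x i :: block x i.+1 n.
Proof. by rewrite -add1n block_add {1}/block /mkseq /= addn0 addn1. Qed.

Lemma block_rcons x i n : block x i n.+1 = rcons (block x i n) (x (i + n)).
Proof. by rewrite -addn1 block_add -cats1 {2}/block /mkseq /= addn0. Qed.

Lemma eq_blockP x i j n :
  (forall k, k < n -> x (i + k) = x (j + k)) <-> block x i n = block x j n.
Proof.
split=> [eqx | eqb k ltkn]; last by rewrite -!(nth_block _ _ ltkn) eqb.
apply: (@eq_from_nth _ false) => [|k]; rewrite !size_block // => ltkn.
by rewrite !nth_block // eqx.
Qed.

Lemma is_factor_block x i n : is_factor x (block x i n).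
Proof. by exists i; rewrite size_block. Qed.

Lemma is_factor_rcons x u :
  is_factor x u <-> exists b, is_factor x (rcons u b).
Proof.
split=> [[i eqi] | [b [i]]].
  exists (x (i + size u)), i; by rewrite size_rcons block_rcons -eqi.
by rewrite size_rcons block_rcons => /rcons_inj[eqi _]; exists i.
Qed.

Lemma is_factor_catr x u v : is_factor x (u ++ v) -> is_factor x v.
Proof.
case=> i; rewrite size_cat block_add => /eqP.
by rewrite eqseq_cat ?size_block // => /andP[_ /eqP eqv]; exists (i + size u).
Qed.

(** * Right special factors and eventual periodicity *)

Definition right_special (x : nat -> bool) (u : seq bool) : Prop :=
  forall b, is_factor x (rcons u b).

Lemma right_special_catr x u v : right_special x (u ++ v) -> right_special x v.
Proof. by move=> rs b; apply: (@is_factor_catr _ u); rewrite -rcons_cat. Qed.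

Definition eventually_periodic (x : nat -> bool) : Prop :=
  exists i p, 0 < p /\ forall t, i <= t -> x (t + p) = x t.

Lemma next_letter x n i j :
  block x i n = block x j n -> ~ right_special x (block x i n) ->
  x (i + n) = x (j + n).
Proof.
move=> eqij nrs; apply: contrapT => /eqP neq; apply: nrs => b.
have [-> | neqb] := eqVneq b (x (i + n)).
  by rewrite -block_rcons; apply: is_factor_block.
have -> : b = x (j + n) by move: neqb neq; case: b; case: (x _); case: (x _).
by rewrite eqij -block_rcons; apply: is_factor_block.
Qed.

(* A factor that is not right special determines the next letter, so the
   sequence of windows loops. *)
Lemma repeated_block_eventually_periodic x n j k :
  j < k -> block x j n = block x k n ->
  (forall t, j <= t < k -> ~ right_special x (block x t n)) ->
  eventually_periodic x.
Proof.
move=> ltjk eqjk nrs.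
have loop t : block x (j + t) n = block x (k + t) n /\
              ~ right_special x (block x (j + t) n).
  elim/ltn_ind: t => t IHt.
  have eqt : block x (j + t) n = block x (k + t) n.
    case: t IHt => [|t] IHt; first by rewrite !addn0.
    have [eqt nrst] := IHt t (ltnSn t).
    have: block x (j + t) n.+1 = block x (k + t) n.+1.
      by rewrite !block_rcons (next_letter eqt nrst) eqt.
    by rewrite !blockS !addnS => -[].
  (* From position k on, the window repeats the one k - j places earlier, so the induction
     hypothesis also rules out right speciality here. *)
  split=> //; have [lttk | lekt] := ltnP (j + t) k.
    by apply: nrs; rewrite leq_addr.
  have ltt : t - (k - j) < t by lia.
  have [eqt' nrst] := IHt _ ltt; move: nrst; rewrite eqt'.
  by rewrite (_ : k + (t - (k - j)) = j + t) //; lia.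
exists (j + n), (k - j); split=> [|t le_t]; first by rewrite subn_gt0.
have [eqt nrst] := loop (t - (j + n)).
have := next_letter eqt nrst.
have -> : j + (t - (j + n)) + n = t by lia.
by have -> : k + (t - (j + n)) + n = t + (k - j) by lia.
Qed.

(** Every tail of such a word agrees with a tail starting before i + p, so there are at most i + p
    factors of length i + p, one fewer than a sturmian word has. *)
Lemma sturmian_not_eventually_periodic x :
  sturmian x -> ~ eventually_periodic x.
Proof.
move=> stx [i [p [p_gt0 per_x]]].
have redx j : exists2 k, k < i + p & forall t, x (j + t) = x (k + t).
  elim/ltn_ind: j => j IHj; have [ltj | lej] := ltnP j (i + p).
    by exists j.
  have [|k ltk eqk] := IHj (j - p); first by lia.
  exists k => // t; rewrite -eqk -[RHS]per_x; last by lia.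
  by congr x; lia.
have [F [inF cardF]] := stx (i + p).
pose blk (k : 'I_(i + p)) : (i + p).-tuple bool :=
  Tuple (introT eqP (size_block x k (i + p))).
suff: #|F| <= i + p by rewrite cardF ltnn.
rewrite -[leqRHS]card_ord -[leqRHS]cardsT.
apply: leq_trans (leq_imset_card blk _); apply: subset_leq_card.
apply/subsetP => u /inF[j equ]; have [k ltk eqk] := redx j.
apply/imsetP; exists (Ordinal ltk) => //; apply: val_inj => /=.
by rewrite equ size_tuple; apply/eq_blockP => t _.
Qed.

(** * Counting factors by their right extensions *)

Definition extensions n (F : {set n.+1.-tuple bool}) (b : bool) :
  {set n.-tuple bool} := [set u : n.-tuple bool | [tuple of rcons u b] \in F].

Lemma card_extensions n (F : {set n.+1.-tuple bool}) :
  #|F| = #|extensions F true :|: extensions F false| +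
         #|extensions F true :&: extensions F false|.
Proof.
pose ext b (u : n.-tuple bool) := [tuple of rcons u b].
have ext_inj b : injective (ext b).
  by move=> u v /(congr1 val) /rcons_inj[] /val_inj.
have disj : (ext true @: extensions F true)
            :&: (ext false @: extensions F false) = set0.
  apply/setP => v; rewrite !inE.
  apply/negP => /andP[/imsetP[u _ ->] /imsetP[w _]].
  by move/(congr1 val) => /rcons_inj[].
rewrite cardsUI -(card_imset _ (ext_inj true)) -(card_imset _ (ext_inj false)).
rewrite -cardsUI disj cards0 addn0.
congr #|pred_of_set _|; apply/setP => v; rewrite inE.
apply/idP/orP => [vF | []/imsetP[u]]; last 2 first.
- by rewrite inE => ? ->.
- by rewrite inE => ? ->.
have [u [b eqv]] : exists u : n.-tuple bool, exists b, v = ext b u.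
  case/tupleP: v {vF} => c v; exists (belast_tuple c v), (last c v).
  by apply: val_inj; rewrite /= -lastI.
have uF : u \in extensions F b by rewrite inE -/(ext b u) -eqv.
by case: b eqv uF => eqv uF; [left | right]; apply/imsetP; exists u.
Qed.

(** Every factor extends to the right in at least one way, and the right special ones in two; so the
    first difference of the factor complexity counts right special factors. *)
Lemma card_factor_sets x n (F : {set n.-tuple bool})
    (G : {set n.+1.-tuple bool}) :
  (forall u, u \in F <-> is_factor x u) ->
  (forall u, u \in G <-> is_factor x u) ->
  exists2 S : {set n.-tuple bool},
    (forall u, u \in S <-> right_special x u) & #|G| = #|F| + #|S|.
Proof.
move=> inF inG; exists (extensions G true :&: extensions G false) => [u|].
  rewrite !inE; split=> [/andP[/inG rt /inG rf] [] // | rs].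
  by apply/andP; split; apply/inG/rs.
rewrite card_extensions; congr (_ + _); congr #|pred_of_set _|; apply/setP => u.
apply/idP/idP; rewrite !inE.
  by move/orP => []/inG fu; apply/inF/is_factor_rcons;
    [exists true | exists false].
by move/inF/is_factor_rcons => -[[] fu]; apply/orP; [left | right]; apply/inG.
Qed.

Lemma sturmian_right_special_uniq x u v :
  sturmian x -> right_special x u -> right_special x v -> size u = size v ->
  u = v.
Proof.
move=> stx rsu rsv eq_uv.
have [F [inF cardF]] := stx (size u); have [G [inG cardG]] := stx (size u).+1.
have [S inS cardGS] := card_factor_sets inF inG.
have /cards1P[w eqS] : #|S| == 1 by move: cardGS; rewrite cardF cardG; lia.
have uS : in_tuple u \in S by apply/inS.
have vS : Tuple (introT eqP (esym eq_uv)) \in S by apply/inS.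
have {vS} := vS; have {uS} := uS; rewrite eqS !inE => /eqP <- /eqP.
by move/(congr1 val).
Qed.

(** The m + 1 windows avoid one of the m + 1 factors of length m, so two of them coincide. With no
    right special window between these two, the word would be eventually periodic. *)
Lemma sturmian_right_special_window x q m (w : seq bool) :
  sturmian x -> size w = m -> is_factor x w ->
  (forall r, r <= m -> block x (q + r) m <> w) ->
  exists2 r, r <= m & right_special x (block x (q + r) m).
Proof.
move=> stx szw fw nw; apply: contrapT => nrs.
apply: (sturmian_not_eventually_periodic stx).
have [F [inF cardF]] := stx m.
pose blk (k : 'I_m.+1) : m.-tuple bool :=
  Tuple (introT eqP (size_block x (q + k) m)).
have ninj : ~ injective blk.
  move=> inj_blk; suff: m.+1 <= m by rewrite ltnn.
  have wF : Tuple (introT eqP szw) \in F by apply/inF.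
  rewrite -[leqLHS]card_ord -cardsT -(card_imset _ inj_blk).
  have cardFw : #|F :\ Tuple (introT eqP szw)| = m.
    by have := cardsD1 (Tuple (introT eqP szw)) F; rewrite wF cardF => -[].
  rewrite -[leqRHS]cardFw.
  apply/subset_leq_card/subsetP => _ /imsetP[k _ ->]; rewrite !inE.
  apply/andP; split; last by apply/inF/is_factor_block.
  by apply/eqP => /(congr1 val)/=; apply: nw; rewrite -ltnS.
have [j [k [ltjk eqjk]]] : exists j k : 'I_m.+1, j < k /\ blk j = blk k.
  apply: contrapT => nex; apply: ninj => j k eqjk; apply: val_inj.
  by case: (ltngtP j k) => // lt; case: nex; [exists j, k | exists k, j].
apply: (@repeated_block_eventually_periodic x m (q + j) (q + k)).
- by rewrite ltn_add2l.
- by move/(congr1 val): eqjk.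
- move=> t /andP[lejt lttk] rst; apply: nrs; exists (t - q).
    by have := ltn_ord k; lia.
  by rewrite subnKC //; lia.
Qed.

(** * Sturmian words are balanced *)

Definition ones (x : nat -> bool) (i n : nat) : nat := count id (block x i n).

Lemma ones1 x i : ones x i 1 = x i.
Proof. by rewrite /ones blockS /= addn0. Qed.

Lemma ones_add x i m n : ones x i (m + n) = ones x i m + ones x (i + m) n.
Proof. by rewrite /ones block_add count_cat. Qed.

Lemma onesS x i n : ones x i n.+1 = ones x i n + x (i + n).
Proof. by rewrite -addn1 ones_add ones1. Qed.

Definition balanced (x : nat -> bool) : Prop :=
  forall i j n, ones x i n <= (ones x j n).+1.

(* The windows at i and at j are 1w1 and 0w0, with w a palindrome. *)
Lemma minimal_unbalanced_pair x n i j :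
  (forall m, m < n -> forall i j, ones x i m <= (ones x j m).+1) ->
  (ones x j n).+1 < ones x i n ->
  [/\ 1 < n, x i /\ ~~ x j, x (i + n.-1) /\ ~~ x (j + n.-1),
      forall k, 0 < k < n.-1 -> x (i + k) = x (j + k) &
      forall k, k < n -> x (i + k) = x (i + (n.-1 - k))].
Proof.
move=> bal unb.
have diff m : 0 < m < n -> ones x i m = (ones x j m).+1.
  move=> /andP[m_gt0 ltmn]; have := unb.
  rewrite -(subnKC (ltnW ltmn)) !ones_add.
  have := bal m ltmn i j; have := bal (n - m) _ (i + m) (j + m).
  have -> : n - m < n by lia.
  by move=> /(_ isT); lia.
have n_gt1 : 1 < n.
  case: n unb {bal diff} => [|[|n]] //.
  by rewrite !ones1; case: (x i); case: (x j).
have diffn : ones x i n = (ones x j n).+2.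
  have := diff n.-1; rewrite (_ : 0 < n.-1 < n); last by lia.
  move: unb; rewrite -(prednK (ltnW n_gt1)) !onesS => unb /(_ isT).
  by move: unb; case: (x (i + _)); case: (x (j + _)) => /=; lia.
have x0 : x i /\ ~~ x j.
  by have := diff 1; rewrite n_gt1 !ones1 => /(_ isT); case: (x i); case: (x j).
have xn : x (i + n.-1) /\ ~~ x (j + n.-1).
  have := diff n.-1; rewrite (_ : 0 < n.-1 < n); last by lia.
  move: diffn; rewrite -(prednK (ltnW n_gt1)) !onesS => diffn /(_ isT).
  by move: diffn; case: (x (i + _)); case: (x (j + _)) => /=; lia.
have mid k : 0 < k < n.-1 -> x (i + k) = x (j + k).
  move=> /andP[k_gt0 ltkn]; have := diff k; have := diff k.+1.
  have -> : 0 < k < n by lia.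
  have -> : 0 < k.+1 < n by lia.
  move=> /(_ isT) + /(_ isT); rewrite !onesS.
  by case: (x (i + k)); case: (x (j + k)) => /=; lia.
split=> //.
(* The prefix and the suffix of length m of the window at i each have one more 1 than their
   counterparts at j. Comparing them crosswise by balance in length m makes their counts equal;
   lengths k and k + 1 then give the mirror letters. *)
have rev_ones m : m <= n -> ones x (i + (n - m)) m = ones x i m.
  move=> lemn; have [-> // | m_gt0] := posnP m.
  have [eqm | nem] := eqVneq m n; first by rewrite eqm subnn addn0.
  have ltmn : m < n by lia.
  have := diff m; have := diff (n - m).
  have -> : 0 < m < n by lia.
  have -> : 0 < n - m < n by lia.
  move=> /(_ isT) + /(_ isT).
  have := bal m ltmn (i + (n - m)) j; have := bal m ltmn i (j + (n - m)).
  have := diffn; rewrite -{1 2}(subnK lemn) !ones_add.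
  by lia.
move=> k ltkn; have := rev_ones k ltac:(lia); have := rev_ones k.+1 ltkn.
rewrite (onesS x i k) (_ : n - k = (n - k.+1).+1); last by lia.
rewrite -(add1n k) ones_add ones1 add1n addn1 addnS.
rewrite (_ : n.-1 - k = n - k.+1); last by lia.
by case: (x (i + k)); case: (x (i + (n - k.+1))) => /=; lia.
Qed.

(* An occurrence of aw inside bwb, with w a palindrome and a != b, would place
   the letters a and b at mirror positions of w. *)
Lemma palindrome_window_neq x p q n a :
  x q = ~~ a -> x (q + n.+1) = ~~ a ->
  (forall k, k <= n.+1 -> x (q + k) = x (q + (n.+1 - k))) ->
  x p = a -> (forall k, 0 < k < n.+1 -> x (p + k) = x (q + k)) ->
  forall r, r <= n.+1 -> block x (q + r) n.+1 <> block x p n.+1.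
Proof.
move=> xq xqn pal xp xpq r ler /eq_blockP eqb.
have xr : x (q + r) = a by rewrite -[q + r]addn0 eqb // addn0.
have [r0 | r_gt0] := posnP r; first by move: xr; rewrite r0 addn0 xq; case: (a).
have [rn | nrn] := eqVneq r n.+1; first by move: xr; rewrite rn xqn; case: (a).
(* The last letter of bwb is b and sits at offset n + 1 - r of the window; the assumed equality
   makes it the mirror image of the letter at q + r, which is a. *)
have := eqb (n.+1 - r) ltac:(lia); rewrite -addnA subnKC // xqn.
rewrite xpq; last by lia.
by rewrite -pal // xr; case: (a).
Qed.

Lemma sturmian_balanced x : sturmian x -> balanced x.
Proof.
move=> stx i j n; elim/ltn_ind: n i j => n bal i j.
rewrite leqNgt; apply/negP => unb.
have [] := minimal_unbalanced_pair (fun m ltm i j => bal m ltm i j) unb.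
case: n unb {bal} => [|[|n]] //= unb _ [xi xj] [xin xjn] mid pal.
have palj k : k <= n.+1 -> x (j + k) = x (j + (n.+1 - k)).
  move=> lek; have [-> | k_gt0] := posnP k.
    by rewrite subn0 addn0 (negbTE xj) (negbTE xjn).
  have [-> | nek] := eqVneq k n.+1.
    by rewrite subnn addn0 (negbTE xj) (negbTE xjn).
  by rewrite -(mid k) -1?(mid (n.+1 - k)) 1?pal //; lia.
have neqi := @palindrome_window_neq x j i n false xi xin pal (negbTE xj)
  (fun k lek => esym (mid k lek)).
have neqj := @palindrome_window_neq x i j n true (negbTE xj) (negbTE xjn)
  palj xi mid.
have [r ler rsr] := sturmian_right_special_window stx (size_block x j n.+1)
  (is_factor_block x j n.+1) neqi.
have [s les rss] := sturmian_right_special_window stx (size_block x i n.+1)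
  (is_factor_block x i n.+1) neqj.
have eqrs : block x (i + r) n.+1 = block x (j + s) n.+1.
  by apply: sturmian_right_special_uniq stx rsr rss _; rewrite !size_block.
have eqw : block x i.+1 n = block x j.+1 n.
  by apply/eq_blockP => k ltk; rewrite !addSnnS; apply: mid; lia.
(* The central word w is followed by 1 in 1w1 and by 0 in 0w0. *)
have rsw : right_special x (block x i.+1 n).
  case.
    have := is_factor_block x i n.+2.
    rewrite blockS -cat1s => /is_factor_catr.
    by rewrite block_rcons addSnnS xin.
  have := is_factor_block x j n.+2; rewrite blockS -cat1s => /is_factor_catr.
  by rewrite block_rcons addSnnS (negbTE xjn) -eqw.
have rst : right_special x (block x (i + r).+1 n).
  by move: rsr; rewrite blockS -cat1s => /right_special_catr.
have eqt : block x (i + r).+1 n = block x i.+1 n.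
  by apply: sturmian_right_special_uniq stx rst rsw _; rewrite !size_block.
(* The common right special window is thus a letter followed by w. It is not 0w as a window inside
   1w1, and not 1w as a window inside 0w0. *)
have := neqi r ler; have := neqj s les.
rewrite -eqrs blockS eqt [block x i _]blockS [block x j _]blockS -eqw.
by rewrite xi (negbTE xj); case: (x (i + r)).
Qed.

(** * Balanced aperiodic words are sturmian *)

Lemma factor_ones x u v : balanced x -> is_factor x u -> is_factor x v ->
  size u = size v -> count id u <= (count id v).+1.
Proof. by move=> bal [i ->] [j ->]; rewrite !size_block => ->; apply: bal. Qed.

(** By induction the tails agree. If the first letters differed, the factors 1u1 and 0u0 would
    contradict balance. *)
Lemma balanced_right_special_uniq x u v :
  balanced x -> right_special x u -> right_special x v -> size u = size v ->
  u = v.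
Proof.
move=> bal; elim: u v => [|a u IHu] [|b v] //= rsu rsv [eq_uv].
have equv : u = v.
  by apply: IHu eq_uv; [move: rsu | move: rsv];
     rewrite -cat1s => /right_special_catr.
rewrite -{v eq_uv}equv in rsv *; congr (_ :: _).
case: a b rsu rsv => -[] // rsu rsv.
  have := factor_ones bal (rsu true) (rsv false).
  by rewrite /= -!cats1 !size_cat !count_cat /= => /(_ erefl); lia.
have := factor_ones bal (rsv true) (rsu false).
by rewrite /= -!cats1 !size_cat !count_cat /= => /(_ erefl); lia.
Qed.

(** There are finitely many words of length n, so some window repeats; without right special factors
    the word would loop from there on. *)
Lemma not_eventually_periodic_right_special x n :
  ~ eventually_periodic x -> exists i, right_special x (block x i n).
Proof.
move=> nper; apply: contrapT => nrs; apply: nper.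
pose blk (k : 'I_#|{: n.-tuple bool}|.+1) : n.-tuple bool :=
  Tuple (introT eqP (size_block x k n)).
have ninj : ~ injective blk by move/leq_card; rewrite card_ord ltnn.
have [j [k [ltjk eqjk]]] :
    exists j k : 'I_#|{: n.-tuple bool}|.+1, j < k /\ blk j = blk k.
  apply: contrapT => nex; apply: ninj => j k eqjk; apply: val_inj.
  by case: (ltngtP j k) => // lt; case: nex; [exists j, k | exists k, j].
apply: (@repeated_block_eventually_periodic x n j k) => //.
  by move/(congr1 val): eqjk.
by move=> t _ rst; apply: nrs; exists t.
Qed.

(** The complexity is 1 at length 0 and grows by one at each length: aperiodicity yields a right
    special factor and balance makes it unique. *)
Lemma balanced_sturmian x :
  balanced x -> ~ eventually_periodic x -> sturmian x.
Proof.
move=> bal nper.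
pose F n := [set u : n.-tuple bool | `[<is_factor x u>]].
have inF n (u : n.-tuple bool) : u \in F n <-> is_factor x u.
  by rewrite inE; split=> /asboolP.
move=> n; exists (F n); split=> //; elim: n => [|n IHn].
  apply/eqP/cards1P; exists [tuple]; apply/setP => u; rewrite tuple0 !inE eqxx.
  by apply/asboolP; exists 0.
have [S inS ->] := card_factor_sets (@inF n) (@inF n.+1).
have [i rsi] := not_eventually_periodic_right_special n nper.
rewrite IHn -[RHS]addn1; congr (_ + _); apply/eqP/cards1P.
exists (Tuple (introT eqP (size_block x i n))); apply/setP => u; rewrite !inE.
apply/idP/eqP => [/inS rsu | ->]; last exact/inS.
apply/val_inj/(balanced_right_special_uniq bal rsu rsi).
by rewrite size_tuple size_block.
Qed.

(** * The word of slope sqrt 2 - 1 *)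

(** The 2-adic valuation is even on the left and odd on the right. *)
Lemma sqrt2_irrational p q : 0 < p -> q * q != 2 * (p * p).
Proof.
move=> p_gt0; apply/eqP => eqpq; have q_gt0 : 0 < q by nia.
have := congr1 (fun m => odd (logn 2 m)) eqpq.
by rewrite !lognM ?muln_gt0 ?p_gt0 // !addnn /= !odd_double.
Qed.

(** The integer part of n sqrt 2, as a bounded search over naturals so that prefixes of the word can
    be computed. *)
Definition floor_sqrt2 (n : nat) : nat :=
  find (fun k => 2 * n * n < k.+1 * k.+1) (iota 0 (2 * n)).

Lemma floor_sqrt2P n :
  floor_sqrt2 n * floor_sqrt2 n <= 2 * n * n <
    (floor_sqrt2 n).+1 * (floor_sqrt2 n).+1.
Proof.
rewrite /floor_sqrt2; set a := fun k => _; set s := iota _ _.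
have nth_s k : k < 2 * n -> nth 0 s k = k by move=> ltk; rewrite nth_iota.
have szs : size s = 2 * n by rewrite size_iota.
apply/andP; split; last first.
  (* A failed search returns 2n, as happens for n = 0, and the bound still holds there. *)
  have [lt | ge] := ltnP (find a s) (2 * n); last by nia.
  have := nth_find 0 (_ : has a s); rewrite has_find szs => /(_ lt).
  by rewrite nth_s.
have := find_size a s; rewrite szs; case def_k: (find a s) => [|k] // lek.
have := @before_find _ 0 a s k; rewrite def_k => /(_ (ltnSn k)).
by rewrite nth_s // /a => /negbT; rewrite -leqNgt.
Qed.

Lemma floor_sqrt2_add m n :
  floor_sqrt2 m + floor_sqrt2 n <= floor_sqrt2 (m + n) <=
    (floor_sqrt2 m + floor_sqrt2 n).+1.
Proof.
have /andP[] := floor_sqrt2P m; have /andP[] := floor_sqrt2P n.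
have /andP[] := floor_sqrt2P (m + n).
move: (floor_sqrt2 m) (floor_sqrt2 n) (floor_sqrt2 (m + n)) => a b c.
move=> lec ltc leb ltb lea lta.
apply/andP; split.
  (* After expanding squares only the cross terms remain to be compared. Multiplying the bounds for
     m and n compares their squares. *)
  have leab : a * b <= 2 * m * n.
    rewrite -leq_sqr; have := leq_mul lea leb.
    by rewrite !expnS !expn0 !muln1; nia.
  rewrite -ltnS ltnNge; apply/negP => le_c.
  by have := leq_mul le_c le_c; nia.
have ltab : 2 * m * n < a.+1 * b.+1.
  rewrite -ltn_sqr; have := ltn_mul lta ltb.
  by rewrite !expnS !expn0 !muln1; nia.
rewrite leqNgt; apply/negP => lt_c.
by have := leq_mul lt_c lt_c; nia.
Qed.

(* The mechanical word of slope sqrt 2 - 1 and intercept 0; each step of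
   [floor_sqrt2] is 1 or 2. *)
Definition sqrt2_word (n : nat) : bool :=
  (floor_sqrt2 n).+1 < floor_sqrt2 n.+1.

Lemma ones_sqrt2_word i n :
  floor_sqrt2 (i + n) = floor_sqrt2 i + n + ones sqrt2_word i n.
Proof.
elim: n => [|n IHn]; first by rewrite !addn0.
rewrite onesS addnS [sqrt2_word (i + n)]/sqrt2_word.
have := floor_sqrt2_add (i + n) 1; rewrite (_ : floor_sqrt2 1 = 1) // !addn1.
by case: (ltnP (floor_sqrt2 (i + n)).+1) => /=; lia.
Qed.

(** By [floor_sqrt2_add], a window of length n has [floor_sqrt2 n - n] ones or one more, wherever it
    starts. *)
Lemma balanced_sqrt2_word : balanced sqrt2_word.
Proof.
move=> i j n.
have := ones_sqrt2_word i n; have := ones_sqrt2_word j n.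
by have := floor_sqrt2_add i n; have := floor_sqrt2_add j n; lia.
Qed.

(** A period p makes [floor_sqrt2] grow by a fixed q every p steps, which forces q / p to be sqrt
    2. *)
Lemma sqrt2_word_not_eventually_periodic : ~ eventually_periodic sqrt2_word.
Proof.
case=> i [p [p_gt0 perp]].
pose q := ones sqrt2_word i p + p.
have onesp m : ones sqrt2_word (i + m * p) p = ones sqrt2_word i p.
  elim: m => [|m <-]; first by rewrite addn0.
  congr count; apply/eq_blockP => k _.
  by rewrite mulSn -[RHS]perp; [congr sqrt2_word; lia | lia].
have fl m : floor_sqrt2 (i + m * p) = floor_sqrt2 i + m * q.
  elim: m => [|m IHm]; first by rewrite !addn0.
  by rewrite mulSnr addnA ones_sqrt2_word onesp IHm /q; lia.
have := sqrt2_irrational q p_gt0; case: ltngtP => // ltpq _.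
  (* If q^2 < 2p^2, then (c + mq)^2 > 2(i + mp)^2 implies m^2 < 2qcm + c^2, which fails for this
     m. *)
  pose c := (floor_sqrt2 i).+1; pose m := 2 * q * c + c * c.
  have /andP[_] := floor_sqrt2P (i + m * p); rewrite fl -addSn -/c.
  have mm : m * m = 2 * q * c * m + c * c * m by rewrite -mulnDl.
  have m_gt0 : 0 < m by rewrite /m /c; nia.
  have := leq_mul (leqnn (m * m)) ltpq.
  have : c * c <= c * c * m by rewrite leq_pmulr.
  by move: mm; clearbody m c; nia.
(* If q^2 > 2p^2, the lower bound on the square implies m^2 <= 4ipm + 2i^2, which fails for this
   m. *)
pose m := 4 * i * p + 2 * i * i + 1.
have /andP[+ _] := floor_sqrt2P (i + m * p); rewrite fl.
have mm : m * m = 4 * i * p * m + 2 * i * i * m + m.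
  by rewrite {1}/m !mulnDl mul1n.
have m_gt0 : 0 < m by rewrite /m addn1.
have := leq_mul (leqnn (m * m)) ltpq.
have : 2 * i * i <= 2 * i * i * m by rewrite leq_pmulr.
by move: mm m_gt0; clearbody m; nia.
Qed.

Lemma sturmian_sqrt2_word : sturmian sqrt2_word.
Proof.
exact: balanced_sturmian balanced_sqrt2_word sqrt2_word_not_eventually_periodic.
Qed.

(** * Periods and a decidable test for cubes *)

Lemma is_periodP w p :
  reflect [/\ 0 < p, p <= size w &
             forall i, i + p < size w -> nth false w i = nth false w (i + p)]
          (is_period w p).
Proof.
apply: (iffP and3P) => [] [p_gt0 lep].
  move/forallP => perp; split=> // i lti.
  have lti' : i < size w - p by lia.
  exact/eqP/(perp (Ordinal lti')).
move=> perp; split=> //; apply/forallP => i.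
by apply/eqP/perp; have := ltn_ord i; lia.
Qed.

Lemma per_is_period w : w != [::] -> is_period w (per w).
Proof.
move=> w_n0; rewrite /per.
apply: (big_ind (fun p => is_period w p)) => // [|p q perp perq].
  by apply/is_periodP; split=> //; [rewrite lt0n size_eq0 | lia].
by rewrite /minn; case: ifP.
Qed.

Lemma per_min w p : is_period w p -> per w <= p.
Proof.
move=> perp; have : p \in index_iota 1 (size w).+1.
  by case/is_periodP: (perp) => p_gt0 lep _; rewrite mem_index_iota p_gt0 ltnS.
rewrite /per; elim: index_iota => //= q s IHs; rewrite inE big_cons.
case/predU1P => [<- | /IHs les]; first by rewrite perp geq_minl.
by case: ifP => _ //; apply: leq_trans (geq_minr _ _) les.
Qed.

Lemma cubeP w : cube w <-> w != [::] /\ 3 * per w = size w.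
Proof.
have ceilE : Num.ceil (3%:R * (per w)%:R : rat)%R = Posz (3 * per w).
  by rewrite -GRing.natrM; apply: (Num.Theory.intrKceil (Posz _)).
split=> [[_ w_n0] | [w_n0 eqw]]; first by rewrite ceilE => -[].
by split=> //; rewrite ceilE eqw.
Qed.

(** A computable test in which p may be any period of the last 3p letters, not only the smallest
    one. *)
Definition ends_cube (x : nat -> bool) (n : nat) : bool :=
  has (fun p =>
         all (fun k => x (n - 3 * p + k) == x (n - 2 * p + k)) (iota 0 (2 * p)))
      (iota 1 (n %/ 3)).

Lemma ends_cubeP x n :
  reflect (exists p, [/\ 0 < p, 3 * p <= n &
             forall k, k < 2 * p -> x (n - 3 * p + k) = x (n - 3 * p + k + p)])
          (ends_cube x n).
Proof.
apply: (iffP hasP) => [[p] | [p [p_gt0 lep eqp]]].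
  rewrite mem_iota => /andP[p_gt0 ltp] /allP eqp.
  have lep : 3 * p <= n by lia.
  exists p; split=> // k ltk; have := eqp k.
  by rewrite mem_iota add0n => /(_ ltk)/eqP->; congr x; lia.
exists p; first by rewrite mem_iota; lia.
apply/allP => k; rewrite mem_iota => /= ltk; apply/eqP.
by rewrite eqp; [congr x; lia | lia].
Qed.

(** Choose the least p that passes the test at n. A smaller period q of the block of length 3p would
    also be a period of its suffix of length 3q, so q would pass the test too; hence p is the
    smallest period. *)
Lemma cube_endsP x n : reflect (cube_ends x n) (ends_cube x n).
Proof.
apply: (iffP (ends_cubeP x n)) => [exp | [m [m_gt0 lem /cubeP[w_n0]]]].
  pose P p := (3 * p <= n) && is_period (block x (n - 3 * p) (3 * p)) p.
  have exP : exists p, P p.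
    case: exp => p [p_gt0 lep eqp]; exists p; rewrite /P lep.
    apply/is_periodP; rewrite size_block; split=> //; first by lia.
    move=> i lti; rewrite !nth_block; try lia.
    by rewrite eqp ?addnA //; lia.
  have [p /andP[lep perp] minp] := ex_minnP exP.
  have [p_gt0 _ eqp] := is_periodP _ _ perp.
  exists (3 * p); split=> //; first by lia.
  have w_n0 : block x (n - 3 * p) (3 * p) != [::].
    by rewrite -size_eq0 size_block; lia.
  apply/cubeP; split=> //; rewrite size_block.
  have leq := per_min perp; have := per_is_period w_n0.
  move: (per _) leq => q leq /is_periodP[q_gt0 _].
  rewrite size_block in eqp * => eqq.
  suff : p <= q by lia.
  apply: minp; rewrite /P; have -> /= : 3 * q <= n by lia.
  apply/is_periodP; rewrite size_block; split=> //; first by lia.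
  move=> i lti; rewrite !nth_block; try lia.
  have := eqq (3 * p - 3 * q + i); rewrite !nth_block; try lia.
  have -> : n - 3 * p + (3 * p - 3 * q + i) = n - 3 * q + i by lia.
  have -> : n - 3 * p + (3 * p - 3 * q + i + q) = n - 3 * q + (i + q) by lia.
  by apply; lia.
have /is_periodP[] := per_is_period w_n0; move: (per _) => p p_gt0 _.
rewrite size_block => eqp eqm; exists p; split=> //; first by lia.
move=> k ltk; have := eqp k; rewrite !nth_block; try lia.
by rewrite eqm addnA; apply; lia.
Qed.

Lemma ends_cube_block x i m n :
  n <= m -> ends_cube (nth false (block x i m)) n -> ends_cube x (i + n).
Proof.
move=> lenm /ends_cubeP[p [p_gt0 lep eqp]]; apply/ends_cubeP; exists p.
split=> //; first by lia.
move=> k ltk; have := eqp k ltk; rewrite !nth_block; try lia.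
have -> : i + (n - 3 * p + k) = i + n - 3 * p + k by lia.
by have -> : i + (n - 3 * p + k + p) = i + n - 3 * p + k + p by lia.
Qed.

(** A prefix contains every letter before position n, so here the converse of [ends_cube_block]
    holds as well. *)
Lemma ends_cube_prefix x m n :
  n <= m -> ends_cube (nth false (block x 0 m)) n = ends_cube x n.
Proof.
move=> lenm; apply/idP/idP => [/(ends_cube_block lenm) // |].
case/ends_cubeP => p [p_gt0 lep eqp]; apply/ends_cubeP; exists p.
split=> // k ltk; by rewrite !nth_block ?eqp //; lia.
Qed.

(** * Exhaustive search over balanced words *)

(* Only prefixes are compared with the other factors, which suffices when all
   suffixes are already known to be balanced. *)
Definition balanced_prefixes (w : seq bool) : bool :=
  all (fun m =>
    let c := count id (take m w) in
    all (fun i => let d := count id (take m (drop i w)) in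
                  (c <= d.+1) && (d <= c.+1))
        (iota 0 (size w - m).+1))
    (iota 0 (size w).+1).

(** Filtering at every length, rather than once at the end, avoids listing all 2^n words. *)
Fixpoint balanced_words (n : nat) : seq (seq bool) :=
  if n is n'.+1 then
    [seq v <- [seq b :: w | w <- balanced_words n', b <- [:: false; true]]
           | balanced_prefixes v]
  else [:: [::]].

Lemma drop_take_block x i n k m :
  k + m <= n -> take m (drop k (block x i n)) = block x (i + k) m.
Proof.
move=> le_n; rewrite -(subnKC (leq_trans (leq_addr m k) le_n)) block_add.
rewrite drop_size_cat ?size_block // (_ : n - k = m + (n - k - m)); last by lia.
by rewrite block_add take_size_cat ?size_block.
Qed.

Lemma balanced_prefixes_block x i n :
  balanced x -> balanced_prefixes (block x i n).
Proof.
move=> bal; apply/allP => m; rewrite mem_iota size_block => ltm.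
apply/allP => k; rewrite mem_iota => ltk.
rewrite -[in take m (block _ _ _)](drop0 (block x i n)) !drop_take_block;
  try lia.
by apply/andP; split; apply: bal.
Qed.

Lemma block_balanced_words x i n :
  balanced x -> block x i n \in balanced_words n.
Proof.
move=> bal; elim: n i => [|n IHn] i //.
rewrite mem_filter balanced_prefixes_block // blockS.
by apply/allpairsP; exists (block x i.+1 n, x i); split; case: (x i) => /=.
Qed.

(* 17 is the least length for which this holds. *)
Lemma balanced_words17_ends_cube :
  all (fun w => has (fun k => ends_cube (nth false w) (8 + k)) (iota 0 10))
      (balanced_words 17).
Proof. by vm_compute. Qed.

(* Near the left end of the infinite word there is no room for a window of
   length 17. *)
Lemma balanced_words_short_gap :
  all (fun n =>
    all (fun w => ends_cube (nth false w) n ==>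
           has (fun k => ends_cube (nth false w) (n.+1 + k)) (iota 0 10))
        (balanced_words (n + 10)))
    (iota 0 7).
Proof. by vm_compute. Qed.

Lemma balanced_ends_cube_window x i :
  balanced x -> exists2 k, k < 10 & ends_cube x (i + 8 + k).
Proof.
move=> bal.
have /hasP[k] :=
  allP balanced_words17_ends_cube _ (block_balanced_words i 17 bal).
rewrite mem_iota => /= ltk ec; exists k => //; rewrite -addnA.
by apply: ends_cube_block ec; lia.
Qed.

Lemma balanced_ends_cube_next x n :
  balanced x -> ends_cube x n -> exists2 k, k < 10 & ends_cube x (n.+1 + k).
Proof.
move=> bal ecn; have [lt7 | ge7] := ltnP n 7.
  have /allP gap :=
    allP balanced_words_short_gap n (etrans (mem_iota 0 7 n) lt7).
  have := gap _ (block_balanced_words 0 (n + 10) bal).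
  rewrite ends_cube_prefix ?leq_addr // ecn => /hasP[k].
  rewrite mem_iota => /= ltk; rewrite ends_cube_prefix; last by lia.
  by exists k.
(* The window starts at n - 7 so that its last ten positions are n + 1 to n + 10. *)
have [k ltk] := balanced_ends_cube_window (n - 7) bal.
by rewrite (_ : n - 7 + 8 = n.+1); [exists k | lia].
Qed.

(** * Enumerating a set with bounded gaps *)

Definition next_within (P : pred nat) (G n : nat) : nat :=
  n.+1 + find P (iota n.+1 G).

Lemma next_withinP (P : pred nat) G n :
  (exists2 k, k < G & P (n.+1 + k)) ->
  [/\ P (next_within P G n), next_within P G n - n <= G &
     forall m, n < m < next_within P G n -> ~~ P m].
Proof.
case=> k ltk Pk.
have hasP : has P (iota n.+1 G).
  by apply/hasP; exists (n.+1 + k) => //; rewrite mem_iota; lia.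
have ltf : find P (iota n.+1 G) < G.
  by rewrite -[X in _ < X](size_iota n.+1) -has_find.
split; rewrite /next_within; first by have := nth_find 0 hasP; rewrite nth_iota.
  by lia.
move=> m /andP[ltnm ltm]; have := @before_find _ 0 P (iota n.+1 G) (m - n.+1).
rewrite nth_iota; last by lia.
by rewrite subnKC // => -> //; lia.
Qed.

Lemma increasing_enum_bounded_gaps (P : pred nat) G :
  (exists n, P n) ->
  (forall n, P n -> exists2 k, k < G & P (n.+1 + k)) ->
  exists p, increasing_enum P p /\ (forall i, p i.+1 - p i <= G).
Proof.
move=> exP nextP; have [n0 Pn0 min0] := ex_minnP exP.
pose p i := iter i (next_within P G) n0.
have Pp i : P (p i) by elim: i => //= i /nextP/next_withinP[].
have ltp i : p i < p i.+1 by rewrite /= /next_within leq_addr.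
exists p; split; last by move=> i; case: (next_withinP (nextP _ (Pp i))).
split=> // n; split=> [Pn | [i <-] //].
have geid i : i <= p i by elim: i => // i IHi; apply: leq_ltn_trans IHi (ltp i).
(* Take the first term beyond n. The preceding term is at most n, and equals n because no position
   satisfying P lies strictly between consecutive terms. *)
have [i ltn mini] := ex_minnP (ex_intro (fun i => n < p i) n.+1 (geid n.+1)).
case: i ltn mini => [|i] ltn mini.
  by have := min0 n Pn; rewrite leqNgt ltn.
exists i; apply/eqP; rewrite eqn_leq [X in X && _]leqNgt [X in _ && X]leqNgt.
apply/andP; split; apply/negP => lt; first by have := mini i lt; rewrite ltnn.
have [_ _ /(_ n)] := next_withinP (nextP _ (Pp i)).
by rewrite lt ltn Pn => /(_ isT).
Qed.

Lemma increasing_enum_iff P Q p :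
  (forall n, P n <-> Q n) -> increasing_enum P p -> increasing_enum Q p.
Proof. by move=> PQ [ltp enumP]; split=> // n; rewrite -PQ. Qed.

Lemma increasing_enum_next P p m n :
  increasing_enum P p -> P m -> P n -> m < n ->
  (forall k, m < k < n -> ~ P k) -> exists i, p i = m /\ p i.+1 = n.
Proof.
move=> [ltp enumP] /enumP[i <-] /enumP[j <-] ltij gap; exists i; split=> //.
have lep : {homo p : a b / a <= b}.
  move=> a b /subnK <-; elim: (b - a) => // c IHc.
  exact: leq_trans IHc (ltnW (ltp _)).
have ltij' : i < j by rewrite ltnNge; apply/negP => /lep; rewrite leqNgt ltij.
apply/eqP; rewrite eqn_leq lep //= leqNgt; apply/negP => lt.
by apply: (gap (p i.+1)); [rewrite ltp | apply/enumP; exists i.+1].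
Qed.

(** * The bound 10 and its optimality *)

Lemma sturmian_max_gap x : sturmian x -> max_gap_le x 10.
Proof.
move=> /sturmian_balanced bal.
have [k _ eck] := balanced_ends_cube_window 0 bal.
have [p [enump gap]] := @increasing_enum_bounded_gaps (ends_cube x) 10
  (ex_intro (fun n => ends_cube x n) _ eck)
  (fun n => balanced_ends_cube_next bal).
exists p; split=> //; apply: increasing_enum_iff enump => n.
by split=> /cube_endsP.
Qed.

Lemma sqrt2_word_gap :
  [/\ ends_cube sqrt2_word 18, ends_cube sqrt2_word 28 &
      forall k, 18 < k < 28 -> ~~ ends_cube sqrt2_word k].
Proof.
(* Whether a cube ends at a position up to 28 depends only on the first 28 letters, so the claim
   reduces to a computation. *)
pose prefix_ends_cube := ends_cube (nth false (block sqrt2_word 0 28)).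
have : [&& prefix_ends_cube 18, prefix_ends_cube 28 &
           ~~ has prefix_ends_cube (iota 19 9)] by vm_compute.
have eq_ec k : k <= 28 -> prefix_ends_cube k = ends_cube sqrt2_word k.
  exact: ends_cube_prefix.
case/and3P; rewrite (eq_ec 18 isT) (eq_ec 28 isT) => ec18 ec28 /hasPn none.
split=> [||k /andP[ltk gtk]]; [exact ec18 | exact ec28 |].
by rewrite -(eq_ec k (ltnW gtk)); apply: none; rewrite mem_iota ltk.
Qed.

Theorem theorem1 :
  (forall x : nat -> bool, sturmian x -> max_gap_le x 10) /\
  (exists x : nat -> bool, sturmian x /\ max_gap_eq x 10).
Proof.
split; first exact: sturmian_max_gap.
exists sqrt2_word; split; first exact: sturmian_sqrt2_word.
have [p [enump gap]] := sturmian_max_gap sturmian_sqrt2_word.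
exists p; split=> //.
have [/cube_endsP ec18 /cube_endsP ec28 none] := sqrt2_word_gap.
have [//|k ltk /cube_endsP|i [eqi eqSi]] :=
  increasing_enum_next enump ec18 ec28.
  exact/negP/none.
by exists i; rewrite eqi eqSi.
Qed.
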